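(* Let $(f,k)$ be an instance of size-constrained monotone submodular maximization with $k<\epsilon\psi/\ell$. Let $\mathrm{Alg}$ be a randomized algorithm which satisfies the randomized consistency property, has approximation ratio $\alpha$, query complexity $\Phi(n)$ and adaptivity $\Psi(n)$. Then G-DASH with $\mathrm{Alg}$ in place of LAG returns a set $S$ using $O(1/\epsilon)$ MapReduce rounds, $\frac1\epsilon\Psi(\frac n\ell)$ adaptive rounds, $\frac{\ell}{\epsilon}\Phi(\frac n\ell)$ total queries and $O(n/\epsilon)$ communication complexity, such that $\mathbb E[f(S)]\ge(\alpha-\epsilon)\mathrm{OPT}$.
   Context: $\mathcal N$ ground set of size $n$, $f:2^{\mathcal N}\to\mathbb R_{\ge0}$ monotone submodular, $\mathrm{OPT}=\max\{f(S):|S|\le k\}$. MapReduce model: $\ell$ machines each holding at most $\psi$ elements, $\psi\ell=O(n)$, $\ell\le n^{1-c}$ for a constant $c\ge1/2$. Randomized consistency property of $\mathrm{Alg}(Y,\mathbf q)$: for fixed random bits $\mathbf q$ and disjoint $A,B\subseteq\mathcal N$, if $b\notin\mathrm{Alg}(A\cup\{b\},\mathbf q)$ for all $b\in B$ and $\mathrm{Alg}(A,\mathbf q)$ terminates successfully, then $\mathrm{Alg}(A\cup B,\mathbf q)$ terminates successfully and equals $\mathrm{Alg}(A,\mathbf q)$. Approximation ratio $\alpha$: on input $Y$ it returns a subset of $Y$ of size at most $k$ with value at least $\alpha\max\{f(Z):Z\subseteq Y,|Z|\le k\}$. G-DASH with $\mathrm{Alg}$: $S=\emptyset$, $C_0=\emptyset$.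 For $r=1,\dots,\lceil1/\epsilon\rceil$: let $X_{r,i}$ be the elements assigned to machine $i$ when each element of $\mathcal N$ is assigned to a uniformly random machine (fresh in each round); $\mathcal N_{r,i}=X_{r,i}\cup C_{r-1}$; in parallel each machine computes $S_{r,i}=\mathrm{Alg}(\mathcal N_{r,i},\mathbf q)$ (same fixed random bits on every call) and sends it to every machine; $S\leftarrow\arg\max\{f(S),f(S_{r,1}),\dots,f(S_{r,\ell})\}$; $C_r=\bigcup_{i=1}^\ell S_{r,i}\cup C_{r-1}$. Return $S$.
   Formalization: Machine loads are random, so the adaptive-round and query bounds hold with probability at least 1-1/n, with Ψ and Φ evaluated at O(n/ℓ) instead of n/ℓ, ⌈1/ε⌉ for 1/ε, and additive terms for evaluating f(∅) and f(S_{r,i}). *)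

(* Defs.v *)
From HB Require Import structures.
From mathcomp Require Import all_boot all_order all_algebra.
From mathcomp Require Import all_classical all_reals all_analysis.

Set Implicit Arguments.
Unset Strict Implicit.
Unset Printing Implicit Defensive.

Import Order.TTheory GRing.Theory Num.Theory.

Local Open Scope ring_scope.

(* ** Submodular maximization under a cardinality constraint *)

Section SetFunctions.
Variables (N : finType) (R : realType).
Implicit Types (f : {set N} -> R) (A B Y Z : {set N}).

Definition set_nonneg f := forall A, 0 <= f A.

Definition set_monotone f := forall A B, A \subset B -> f A <= f B.

Definition submodular f := forall A B, f (A :|: B) + f (A :&: B) <= f A + f B.

(* max of f over the subsets of Y of size at most k; the default value 0 of the
   iterated maximum is harmless for nonnegative f, the empty set being feasible *)
Definition opt_in f (k : nat) Y : R :=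
  \big[Num.max/0]_(Z : {set N} | (Z \subset Y) && (#|Z| <= k)%N) f Z.

End SetFunctions.

(* ** Adaptive oracle computations

   A computation that accesses a value oracle f : {set N} -> R only through
   [Ask qs next], one adaptive round: the batch qs of sets is evaluated in
   parallel, and everything that follows may depend on the list of answers. *)

Inductive oracle_comp (N : finType) (R A : Type) : Type :=
| Ret of A
| Ask of seq {set N} & (seq R -> oracle_comp N R A).
Arguments Ret {N R A}.
Arguments Ask {N R A}.

Section OracleComputations.
Variables (N : finType) (R A B : Type).
Implicit Types (f : {set N} -> R) (c : oracle_comp N R A).

Fixpoint oracle_bind c (g : A -> oracle_comp N R B) : oracle_comp N R B :=
  match c with
  | Ret x => g x
  | Ask qs next => Ask qs (fun ans => oracle_bind (next ans) g)
  end.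

Fixpoint run f c : A :=
  match c with
  | Ret x => x
  | Ask qs next => run f (next (map f qs))
  end.

Fixpoint adaptivity f c : nat :=
  match c with
  | Ret _ => 0%N
  | Ask qs next => (adaptivity f (next (map f qs))).+1
  end.

Fixpoint queries f c : nat :=
  match c with
  | Ret _ => 0%N
  | Ask qs next => (size qs + queries f (next (map f qs)))%N
  end.

End OracleComputations.

(* ** Randomized algorithms Alg(Y, q)

   W is the space of random bits q. The computation yields [Some T] when it
   terminates successfully with output T, and [None] when it fails. *)

Definition rand_alg (N : finType) (R W : Type) : Type :=
  {set N} -> W -> oracle_comp N R (option {set N}).

Section RandomizedAlgorithms.
Variables (N : finType) (R : realType) (f : {set N} -> R).

Definition alg_succeeds W (Alg : rand_alg N R W) Y q : bool :=
  isSome (run f (Alg Y q)).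

Definition alg_output W (Alg : rand_alg N R W) Y q : {set N} :=
  odflt finset.set0 (run f (Alg Y q)).

Definition randomized_consistency W (Alg : rand_alg N R W) : Prop :=
  forall (q : W) (A B : {set N}), [disjoint A & B] ->
    (forall b, b \in B -> b \notin alg_output Alg (b |: A) q) ->
    alg_succeeds Alg A q ->
    alg_succeeds Alg (A :|: B) q /\
    alg_output Alg (A :|: B) q = alg_output Alg A q.

Definition approx_ratio d (W : measurableType d) (P : probability W R)
    (k : nat) (Alg : rand_alg N R W) (alpha : R) : Prop :=
  forall Y : {set N}, {ae P, forall q,
    [/\ alg_succeeds Alg Y q,
        alg_output Alg Y q \subset Y,
        (#|alg_output Alg Y q| <= k)%N &
        alpha * opt_in f k Y <= f (alg_output Alg Y q)]}.

Definition query_complexity W (Alg : rand_alg N R W) (Phi : nat -> nat) : Prop :=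
  forall (m : nat) (Y : {set N}) (q : W),
    (#|Y| <= m)%N -> (queries f (Alg Y q) <= Phi m)%N.

Definition adaptive_complexity W (Alg : rand_alg N R W) (Psi : nat -> nat) : Prop :=
  forall (m : nat) (Y : {set N}) (q : W),
    (#|Y| <= m)%N -> (adaptivity f (Alg Y q) <= Psi m)%N.

Definition measurable_alg d (W : measurableType d) (Alg : rand_alg N R W) : Prop :=
  forall (Y : {set N}) (T : option {set N}),
    measurable [set q | run f (Alg Y q) = T]%classic.

End RandomizedAlgorithms.

(* ** The MapReduce model with ell machines

   M is the type of local memories. A message carries a set of elements and a
   list of oracle values, and its length is the number of both. In one round
   every machine performs a local oracle computation giving its new memory and
   one message for each machine (itself included), and then incorporates the
   messages it receives. *)

Definition message (N : finType) (R : Type) : Type := {set N} * seq R.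

Definition msg_size (N : finType) (R : Type) (m : message N R) : nat :=
  (#|m.1| + size m.2)%N.

Record mr_round (N : finType) (R : Type) (ell : nat) (M : Type) := MRRound {
  mr_local : 'I_ell -> M -> oracle_comp N R (M * ('I_ell -> message N R));
  mr_receive : 'I_ell -> M -> ('I_ell -> message N R) -> M }.

Section MapReduce.
Variables (N : finType) (R : Type) (ell : nat) (M : Type).
Variable (f : {set N} -> R).
Implicit Types (rd : mr_round N R ell M) (st : 'I_ell -> M).

Definition mr_out rd st (i : 'I_ell) : M * ('I_ell -> message N R) :=
  run f (mr_local rd i (st i)).

Definition mr_step rd st : 'I_ell -> M := fun j =>
  mr_receive rd j (mr_out rd st j).1 (fun i => (mr_out rd st i).2 j).

Fixpoint mr_exec (prog : seq (mr_round N R ell M)) st : 'I_ell -> M :=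
  if prog is rd :: prog' then mr_exec prog' (mr_step rd st) else st.

Definition mr_rounds (prog : seq (mr_round N R ell M)) : nat := size prog.

(* machines work in parallel: adaptive rounds are the maximum over machines *)
Fixpoint mr_adaptivity (prog : seq (mr_round N R ell M)) st : nat :=
  if prog is rd :: prog' then
    (\max_(i < ell) adaptivity f (mr_local rd i (st i))
     + mr_adaptivity prog' (mr_step rd st))%N
  else 0%N.

Fixpoint mr_queries (prog : seq (mr_round N R ell M)) st : nat :=
  if prog is rd :: prog' then
    (\sum_(i < ell) queries f (mr_local rd i (st i))
     + mr_queries prog' (mr_step rd st))%N
  else 0%N.

Fixpoint mr_communication (prog : seq (mr_round N R ell M)) st : nat :=
  if prog is rd :: prog' then
    (\sum_(i < ell) \sum_(j < ell) msg_size ((mr_out rd st i).2 j)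
     + mr_communication prog' (mr_step rd st))%N
  else 0%N.

(* largest number of elements held by a machine at any time *)
Fixpoint mr_memory (held : M -> nat) (prog : seq (mr_round N R ell M)) st : nat :=
  maxn (\max_(i < ell) held (st i))
    (if prog is rd :: prog' then mr_memory held prog' (mr_step rd st) else 0%N).

End MapReduce.

(* ** G-DASH *)

Definition gdash_iters (R : realType) (eps : R) : nat := `|Num.ceil eps^-1|%N.

(* [node_part]: the elements assigned to the machine in the current iteration
   (X_{r,i}); [node_core]: the set C_r; [node_best]: the set S with its value *)
Record node (N : finType) (R : Type) := Node {
  node_part : {set N};
  node_core : {set N};
  node_best : {set N} * R }.

Definition node_held (N : finType) (R : Type) (s : node N R) : nat :=
  (#|node_part s| + #|node_core s| + #|(node_best s).1|)%N.

Section GDash.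
Variables (N : finType) (R : realType) (W : Type) (ell : nat).
Variable Alg : rand_alg N R W.

Notation node := (node N R).
Notation round := (mr_round N R ell node).

Definition better (s t : {set N} * R) : {set N} * R :=
  if s.2 < t.2 then t else s.

(* S := set0, together with its value *)
Definition init_round : round := MRRound
  (fun _ s => Ask [:: finset.set0] (fun ans =>
     Ret (Node (node_part s) (node_core s) (finset.set0, head 0 ans),
          fun _ => (finset.set0, [::]))))
  (fun _ s _ => s).

(* every element x moves to machine [a x] *)
Definition shuffle_round (a : {ffun N -> 'I_ell}) : round := MRRound
  (fun _ s => Ret (s, fun j => ([set x in node_part s | a x == j]%SET, [::])))
  (fun _ s inbox =>
     Node (\bigcup_(i < ell) (inbox i).1)%SET (node_core s) (node_best s)).

(* S_{r,i} := Alg(X_{r,i} :|: C_{r-1}, q), evaluated and broadcast with its value;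
   then S := argmax {f(S), f(S_{r,1}), ...} and C_r := \bigcup_i S_{r,i} :|: C_{r-1} *)
Definition solve_round (q : W) : round := MRRound
  (fun _ s => oracle_bind (Alg (node_part s :|: node_core s) q) (fun res =>
     let T := odflt finset.set0 res in
     Ask [:: T] (fun ans => Ret (s, fun _ => (T, ans)))))
  (fun _ s inbox =>
     Node (node_part s)
          ((\bigcup_(i < ell) (inbox i).1)%SET :|: node_core s)
          (foldl better (node_best s)
             [seq ((inbox i).1, head 0 (inbox i).2) | i <- enum 'I_ell])).

(* the assignments of elements to machines, one for each of the T iterations *)
Definition assignments (T : nat) := {ffun 'I_T -> {ffun N -> 'I_ell}}.

Definition gdash (T : nat) (a : assignments T) (q : W) : seq round :=
  init_round ::
  flatten [seq [:: shuffle_round (a r); solve_round q] | r <- enum 'I_T].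

(* the input is initially distributed according to an arbitrary [a0] *)
Definition gdash_start (a0 : {ffun N -> 'I_ell}) : 'I_ell -> node :=
  fun i => Node [set x | a0 x == i]%SET finset.set0 (finset.set0, 0).

(* the set S as held by machine i at the end (all machines hold the same S) *)
Definition gdash_output (f : {set N} -> R) (a0 : {ffun N -> 'I_ell})
    (T : nat) (a : assignments T) (q : W) (i : 'I_ell) : {set N} :=
  (node_best (mr_exec f (gdash a q) (gdash_start a0) i)).1.

End GDash.

(* ** Uniform distribution on a finite type

   Under the uniform distribution on [assignments], the machines of the elements
   are independent and uniform, afresh in each iteration. *)

Definition unif_mean (T : finType) (R : realType) (F : T -> R) : R :=
  (\sum_(a : T) F a) / #|T|%:R.

Definition unif_prob (T : finType) (R : realType) (E : pred T) : R :=
  #|E|%:R / #|T|%:R.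

(* Main.v *)
(** Fix random bits on which [Alg] meets its guarantees on every input, and let O be
    an optimal set. Given the current core C, an element o of O outside C is either
    returned by the machine it is sent to, and so enters the next core, or it would
    not be returned if it were added to the input X of a fixed machine. The second
    alternative has the complementary probability, by exchanging the two machines.
    By consistency the fixed machine returns the same set on X and on X together with
    the missed elements M, so it achieves alpha f((O :&: C) :|: M). Submodularity then
    gives E f(O :&: C') + E f((O :&: C) :|: M) >= f O + f (O :&: C), where C' is the
    next core. Telescoping over the iterations yields the ratio alpha - eps.

    The core never has more than (2/eps) ell k = O(psi) elements, and by an exponential
    moment bound no machine is assigned more than O(n/ell) elements in any iteration
    with probability at least 1 - 1/n, since n/ell >= sqrt n. *)
Require Import Defs.
From HB Require Import structures.
From mathcomp Require Import all_boot all_order all_algebra.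
From mathcomp Require Import all_classical all_reals all_analysis.
From mathcomp Require Import perm zify ring lra.

Set Implicit Arguments.
Unset Strict Implicit.
Unset Printing Implicit Defensive.

Import Order.TTheory GRing.Theory Num.Theory.

Local Open Scope ring_scope.

(** * One iteration on a submodular function *)

Lemma submodular_diminishing (N : finType) (R : realType) (f : {set N} -> R)
    (A B : {set N}) (x : N) :
  submodular f -> A \subset B -> x \notin B ->
  f (x |: B) - f B <= f (x |: A) - f A.
Proof.
move=> fsub sAB xB; have := fsub (x |: A)%SET B.
have -> : ((x |: A) :|: B = x |: B)%SET by rewrite -finset.setUA (finset.setUidPr sAB).
have -> : ((x |: A) :&: B = A)%SET.
  apply/setP => y; rewrite !inE; case: (eqVneq y x) => [->|_] /=.
    by rewrite (negbTE xB); apply/esym/negbTE; apply: contra xB; apply/fintype.subsetP.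
  by case yA : (y \in A) => //=; rewrite (fintype.subsetP sAB).
lra.
Qed.

(** The weights are the marginal gains when the elements of [E] are added to [D] one at a time: they
    telescope to the full value, and dropping predecessors can only raise a gain. This linear lower
    bound allows expectations to be taken element by element. *)
Lemma submodular_marginals (N : finType) (R : realType) (f : {set N} -> R)
    (D E : {set N}) :
  set_monotone f -> submodular f -> [disjoint D & E] ->
  exists w : N -> R, [/\ forall x, 0 <= w x,
    f (D :|: E)%SET = f D + \sum_(x in E) w x &
    forall A : {set N}, A \subset E -> f D + \sum_(x in A) w x <= f (D :|: A)%SET].
Proof.
move=> fmono fsub; move En : #|E| => n; elim: n E En => [|n IH] E En dDE.
  move/eqP: En; rewrite cards_eq0 => /eqP ->; exists (fun=> 0); split=> //.
    by rewrite big_set0 addr0 finset.setU0.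
  by move=> A; rewrite finset.subset0 => /eqP ->; rewrite big_set0 addr0 finset.setU0.
have /card_gt0P[x xE] : (0 < #|E|)%N by rewrite En.
have dDF : [disjoint D & E :\ x] by apply: disjointWr dDE; apply: subD1set.
have xDF : x \notin (D :|: (E :\ x))%SET.
  by rewrite !inE eqxx /= orbF; apply: contraTN xE => xD; rewrite (disjointFr dDE).
have [|w [w0 wE wA]] := IH (E :\ x)%SET _ dDF.
  by move: En; rewrite (cardsD1 x E) xE => -[].
(* [x] comes last in the order, so its weight is its gain over all the other elements, at most its
   gain over [D :|: (A :\ x)]. *)
pose g := f (x |: (D :|: (E :\ x)))%SET - f (D :|: (E :\ x))%SET.
have DE : (D :|: E = x |: (D :|: (E :\ x)))%SET.
  by rewrite [in LHS]finset.setUC -{1}(finset.setD1K xE) -finset.setUA (finset.setUC _ D).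
exists (fun y => if y == x then g else w y); split.
- by move=> y; case: ifP => // _; rewrite subr_ge0; apply: fmono; apply: finset.subsetUr.
- rewrite DE (big_setD1 x xE) /= eqxx.
  rewrite (eq_bigr w) => [|y]; last by rewrite !inE => /andP[/negbTE ->].
  by rewrite /g wE; lra.
- move=> A AE; have [xA|xA] := boolP (x \in A).
    have sAF : (A :\ x)%SET \subset (E :\ x)%SET by apply: finset.setSD.
    rewrite (big_setD1 x xA) /= eqxx.
    rewrite (eq_bigr w) => [|y]; last by rewrite !inE => /andP[/negbTE ->].
    have := wA _ sAF.
    have := submodular_diminishing fsub (finset.setUS D sAF) xDF.
    have -> : (x |: (D :|: (A :\ x)) = D :|: A)%SET.
      by rewrite -[in RHS](finset.setD1K xA) finset.setUCA.
    by rewrite -/g; lra.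
  rewrite (eq_bigr w) => [|y yA]; last first.
    by case: eqP => // yx; rewrite -yx yA in xA.
  apply: wA; apply/fintype.subsetP => y yA; rewrite !inE (fintype.subsetP AE) // andbT.
  by apply: contraNneq xA => <-.
Qed.

(** Separates the first iteration from the later ones; [G] takes a list because the execution
    recurses over the list of assignments. *)
Lemma sum_ffun_ordS (R : nmodType) (B : finType) T (G : seq B -> R) :
  \sum_(a : {ffun 'I_T.+1 -> B}) G [seq a r | r <- enum 'I_T.+1] =
  \sum_b \sum_(a : {ffun 'I_T -> B}) G (b :: [seq a r | r <- enum 'I_T]).
Proof.
rewrite pair_big /=.
pose cons_ffun (p : B * {ffun 'I_T -> B}) : {ffun 'I_T.+1 -> B} :=
  [ffun i => if unlift ord0 i is Some j then p.2 j else p.1].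
rewrite (reindex cons_ffun) /=; last first.
  exists (fun a : {ffun 'I_T.+1 -> B} => (a ord0, [ffun j => a (lift ord0 j)])).
    case=> b a _; congr (_, _); first by rewrite ffunE unlift_none.
    by apply/ffunP => j; rewrite !ffunE liftK.
  move=> a _; apply/ffunP => i; rewrite ffunE.
  by case: unliftP => [j ->|->] //=; rewrite ffunE.
apply: eq_bigr => -[b a] _; congr G.
rewrite enum_ordSl /= ffunE unlift_none; congr (_ :: _).
by rewrite -map_comp; apply: eq_map => j /=; rewrite ffunE liftK.
Qed.

(** * Exchanging two machines in an assignment *)

Definition part_of (N : finType) ell (a : {ffun N -> 'I_ell}) (i : 'I_ell) : {set N} :=
  [set x | a x == i]%SET.

(* Relabel the machines of the elements other than o so that o's machine and the
   machine out are swapped: an involution that leaves the machine of o unchanged. *)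
Definition relabel (N : finType) ell (out : 'I_ell) (o : N)
    (a : {ffun N -> 'I_ell}) : {ffun N -> 'I_ell} :=
  [ffun x => if x == o then a o else tperm out (a o) (a x)].

Lemma relabelK (N : finType) ell (out : 'I_ell) (o : N) :
  involutive (relabel out o).
Proof.
by move=> a; apply/ffunP => x; rewrite !ffunE eqxx; case: eqP => [->|_] //; rewrite tpermK.
Qed.

Lemma part_of_relabel (N : finType) ell (out : 'I_ell) (o : N) a :
  part_of (relabel out o a) (relabel out o a o) = (o |: part_of a out)%SET.
Proof.
apply/setP => x; rewrite !inE !ffunE eqxx; case: (eqVneq x o) => [_|_]; first by rewrite eqxx.
by rewrite -{2}(tpermL out (a o)) (inj_eq perm_inj).
Qed.

(** * Evolution of the core and of the best set *)

Section Analysis.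
Variables (N : finType) (R : realType) (f : {set N} -> R) (ell : nat).
Variable alg : {set N} -> {set N}.
Implicit Types (a : {ffun N -> 'I_ell}) (C : {set N}) (l : seq {ffun N -> 'I_ell}).

Definition next_core a C : {set N} :=
  ((\bigcup_(i < ell) alg (part_of a i :|: C)) :|: C)%SET.

Definition next_best a C (b : {set N} * R) : {set N} * R :=
  foldl (@better N R) b
    [seq (alg (part_of a i :|: C)%SET, f (alg (part_of a i :|: C)%SET))
    | i <- enum 'I_ell].

Fixpoint final_best l C b : {set N} * R :=
  if l is a :: l' then final_best l' (next_core a C) (next_best a C b) else b.

Fixpoint final_core l C : {set N} :=
  if l is a :: l' then final_core l' (next_core a C) else C.

(** Only the outputs of one fixed machine [i] are summed; the analysis never needs the values of the
    others. *)
Fixpoint total_value (i : 'I_ell) l C : R :=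
  if l is a :: l'
  then f (alg (part_of a i :|: C)%SET) + total_value i l' (next_core a C) else 0.

Lemma foldl_better_ge (b : {set N} * R) s : b.2 <= (foldl (@better N R) b s).2.
Proof.
elim: s b => //= p s IH b; apply: le_trans (IH _).
by rewrite /better; case: ltP => [/ltW|].
Qed.

Lemma foldl_better_ge_mem (b : {set N} * R) s p :
  p \in s -> p.2 <= (foldl (@better N R) b s).2.
Proof.
elim: s b => //= q s IH b; rewrite inE => /orP[/eqP ->|/IH //].
by apply: le_trans (foldl_better_ge _ _); rewrite /better; case: ltP.
Qed.

Lemma foldl_better_mem (b : {set N} * R) s : foldl (@better N R) b s \in b :: s.
Proof.
elim: s b => [|p s IH] b /=; first by rewrite inE.
have := IH (better b p); rewrite !inE => /orP[/eqP ->|->]; last by rewrite !orbT.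
by rewrite /better; case: ifP => _; rewrite eqxx ?orbT.
Qed.

Lemma next_bestP a C b :
  next_best a C b = b \/
  exists Y, next_best a C b = (alg Y, f (alg Y)).
Proof.
have := foldl_better_mem b [seq (alg (part_of a i :|: C)%SET, f (alg (part_of a i :|: C)%SET))
    | i <- enum 'I_ell].
rewrite -/(next_best a C b) inE => /orP[/eqP|/mapP[i _ ->]]; first by left.
by right; exists (part_of a i :|: C)%SET.
Qed.

(** From an initial pair with these properties, the stored value stays the value of the stored set,
    and size bounds on outputs pass to that set. *)
Lemma final_bestP l C b :
  final_best l C b = b \/
  exists Y, final_best l C b = (alg Y, f (alg Y)).
Proof.
elim: l C b => [|a l IH] C b /=; first by left.
case: (IH (next_core a C) (next_best a C b)) => [->|]; last by right.
exact: next_bestP.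
Qed.

Lemma final_best_ge l C b : b.2 <= (final_best l C b).2.
Proof.
elim: l C b => //= a l IH C b; apply: le_trans (IH _ _); exact: foldl_better_ge.
Qed.

Lemma total_value_le i l C b :
  total_value i l C <= (size l)%:R * (final_best l C b).2.
Proof.
elim: l C b => [|a l IH] C b /=; first by rewrite mul0r.
rewrite -natr1 mulrDl mul1r addrC lerD //.
apply: le_trans (final_best_ge _ _ _).
have mi : (alg (part_of a i :|: C), f (alg (part_of a i :|: C)))%SET \in
   [seq (alg (part_of a j :|: C), f (alg (part_of a j :|: C)))%SET | j <- enum 'I_ell].
  by apply/mapP; exists i; rewrite ?mem_enum.
exact: (foldl_better_ge_mem b mi).
Qed.

Lemma card_next_core a C k : (forall Y, #|alg Y| <= k)%N ->
  (#|next_core a C| <= ell * k + #|C|)%N.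
Proof.
move=> ak; apply: leq_trans (leq_card_setU _ _) _; rewrite leq_add2r.
apply: (@leq_trans (\sum_(i < ell) #|alg (part_of a i :|: C)%SET|)).
  by apply: (big_ind2 (fun (A : {set N}) n => #|A| <= n)%N) => [|A m B n Am Bn|//];
    [rewrite cards0 | apply: leq_trans (leq_card_setU _ _) (leq_add Am Bn)].
apply: (@leq_trans (\sum_(i < ell) k)); first by apply: leq_sum.
by rewrite sum_nat_const card_ord.
Qed.

Hypotheses (fmono : set_monotone f) (fsub : submodular f).

(* Reindexing by relabel turns o |: part_of a out into the part of o's own machine. *)
Lemma found_count (out : 'I_ell) o C :
  (\sum_a (o \in alg (o |: part_of a out :|: C)%SET)%:R : R) <=
  \sum_a (o \in next_core a C)%:R.
Proof.
rewrite [leRHS](reindex (relabel out o)) /=; last first.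
  by apply: onW_bij; apply: inv_bij; apply: relabelK.
apply: ler_sum => a _; rewrite ler_nat.
case: (boolP (o \in _)) => // oS; rewrite inE.
have -> // : o \in (\bigcup_(i < ell) alg (part_of (relabel out o a) i :|: C))%SET.
by apply/bigcupP; exists (relabel out o a o) => //; rewrite part_of_relabel.
Qed.

Variables (k : nat) (alpha : R).
Hypothesis alpha0 : 0 < alpha.
Hypothesis alg_consistent : forall A B : {set N}, [disjoint A & B] ->
  (forall b, b \in B -> b \notin alg (b |: A)) -> alg (A :|: B)%SET = alg A.
Hypothesis alg_approx : forall Y Z : {set N}, Z \subset Y -> (#|Z| <= k)%N ->
  alpha * f Z <= f (alg Y).

(* By consistency, adding the missed elements to the input does not change the output. *)
Lemma missed_le (O : {set N}) a i C : (#|O| <= k)%N ->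
  alpha * f ((O :&: C) :|: [set o in O :\: C | o \notin alg (o |: part_of a i :|: C)])%SET
  <= f (alg (part_of a i :|: C)%SET).
Proof.
move=> Ok; set M := [set o in _ | _]%SET.
(* Consistency asks for disjoint sets, so the missed elements already in the input are removed
   first. *)
have <- : alg ((part_of a i :|: C) :|: (M :\: (part_of a i :|: C)))%SET =
          alg (part_of a i :|: C)%SET.
  apply: alg_consistent.
    by rewrite disjoint_sym -setI_eq0; apply/eqP/setP => x; rewrite !inE; case: orP; rewrite ?andbF.
  by move=> b; rewrite !inE finset.setUA => /andP[_ /andP[]].
apply: alg_approx.
  by apply/fintype.subsetP => x; rewrite !inE; do ![case: (_ \in _) => //=]; case: eqP.
apply: leq_trans Ok; apply: subset_leq_card.
by apply/fintype.subsetP => x; rewrite !inE; case: (x \in O); rewrite //= andbF.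
Qed.

(** Each [o] outside [C] contributes its weight to the next core if hit and to machine [i] if
    missed; on average the two indicators sum to at least 1. *)
Lemma round_gain (O C : {set N}) i : (#|O| <= k)%N ->
  \sum_(a : {ffun N -> 'I_ell}) (f O + f (O :&: C)%SET) <=
  \sum_a (f (O :&: next_core a C)%SET + alpha^-1 * f (alg (part_of a i :|: C)%SET)).
Proof.
move=> Ok; have [|w [w0 wO wA]] := @submodular_marginals N R f (O :&: C)%SET (O :\: C)%SET fmono fsub.
  by rewrite -setI_eq0; apply/eqP/setP => x; rewrite !inE; case: (x \in C); rewrite ?andbF.
rewrite (finset.setID O C) in wO.
pose hit a o : R := (o \in next_core a C)%:R.
pose miss a o : R := (o \notin alg (o |: part_of a i :|: C)%SET)%:R.
have step a : f (O :&: C)%SET + \sum_(o in O :\: C) w o * hit a o +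
    (f (O :&: C)%SET + \sum_(o in O :\: C) w o * miss a o) <=
    f (O :&: next_core a C)%SET + alpha^-1 * f (alg (part_of a i :|: C)%SET).
  have restrict (Q : pred N) : \sum_(o in O :\: C) w o * (Q o)%:R =
      \sum_(o in [set o in O :\: C | Q o]%SET) w o.
    rewrite big_mkcond [RHS]big_mkcond /=; apply: eq_bigr => o _.
    by rewrite !inE; case: (_ && _) => //=; case: (Q o); rewrite ?mulr1 ?mulr0.
  rewrite !restrict; apply: lerD.
    apply: le_trans (wA _ _) _; first by apply/fintype.subsetP => x; rewrite inE => /andP[].
    apply: fmono; apply/fintype.subsetP => x; rewrite !inE.
    by do ![case: (_ \in _) => //=].
  apply: le_trans (wA _ _) _; first by apply/fintype.subsetP => x; rewrite inE => /andP[].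
  by rewrite ler_pdivlMl //; apply: missed_le.
apply: le_trans (ler_sum _ (fun a _ => step a)).
rewrite [leRHS](eq_bigr (fun a => f (O :&: C)%SET + f (O :&: C)%SET +
   \sum_(o in O :\: C) w o * (hit a o + miss a o))); last first.
  move=> a _; under [in RHS]eq_bigr do rewrite mulrDr.
  by rewrite big_split /= addrACA.
rewrite !big_split /= addrC -addrA lerD2l wO big_split /= lerD2l.
rewrite [leRHS]exchange_big [leLHS]exchange_big /=.
apply: ler_sum => o _; rewrite -mulr_sumr.
rewrite (eq_bigr (fun=> w o * 1)) => [|? _]; last by rewrite mulr1.
rewrite -mulr_sumr ler_wpM2l // big_split /=.
(* After this replacement of [hit], the two indicators are complementary for every single
   assignment. *)
apply: le_trans (lerD (found_count i o C) (lexx _)).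
by rewrite -big_split /=; apply: ler_sum => a _; rewrite /miss; case: (_ \in _); rewrite ?addr0 ?add0r.
Qed.

(** Telescoping with potential [f (O :&: C)]: the core left by the first iteration is the starting
    core of the induction hypothesis. *)
Lemma total_gain (O : {set N}) i T C : (#|O| <= k)%N ->
  \sum_(a : {ffun 'I_T -> {ffun N -> 'I_ell}}) (T%:R * f O + f (O :&: C)%SET) <=
  \sum_(a : {ffun 'I_T -> {ffun N -> 'I_ell}})
     (f (O :&: final_core [seq a r | r <- enum 'I_T] C)%SET +
      alpha^-1 * total_value i [seq a r | r <- enum 'I_T] C).
Proof.
move=> Ok; elim: T C => [|T IH] C.
  by apply: ler_sum => a _; rewrite enum_ord0 /= mul0r mulr0 add0r addr0.
rewrite (sum_ffun_ordS T (fun=> T.+1%:R * f O + f (O :&: C)%SET)).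
rewrite (sum_ffun_ordS T (fun l => f (O :&: final_core l C)%SET + alpha^-1 * total_value i l C)) /=.
apply: (@le_trans _ _ (\sum_b \sum_(a : {ffun 'I_T -> {ffun N -> 'I_ell}})
   (T%:R * f O + f (O :&: next_core b C)%SET + alpha^-1 * f (alg (part_of b i :|: C)%SET)))); last first.
  apply: ler_sum => b _; under [leRHS]eq_bigr do rewrite mulrDr addrCA.
  rewrite big_split /= [leRHS]big_split /= [leRHS]addrC lerD2r; exact: IH.
(* With the later assignments fixed, only the first one is averaged. *)
rewrite [leLHS]exchange_big [leRHS]exchange_big /=; apply: ler_sum => _ _.
under eq_bigr do rewrite -natr1 mulrDl mul1r -addrA.
under [leRHS]eq_bigr do rewrite -addrA.
by rewrite big_split [leRHS]big_split /= lerD2l round_gain.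
Qed.

End Analysis.

(** * Execution and resources *)

Section OracleBind.
Variables (N : finType) (R A B : Type) (f : {set N} -> R).
Implicit Types (c : oracle_comp N R A) (g : A -> oracle_comp N R B).

Lemma run_bind c g : run f (oracle_bind c g) = run f (g (run f c)).
Proof. by elim: c => //= qs next IH; rewrite IH. Qed.

Lemma queries_bind c g :
  queries f (oracle_bind c g) = (queries f c + queries f (g (run f c)))%N.
Proof. by elim: c => //= qs next IH; rewrite IH addnA. Qed.

Lemma adaptivity_bind c g :
  adaptivity f (oracle_bind c g) = (adaptivity f c + adaptivity f (g (run f c)))%N.
Proof. by elim: c => //= qs next IH; rewrite IH addSn. Qed.

End OracleBind.

Lemma sum_card_fibers (N I : finType) (a : N -> I) (A : {set N}) :
  (\sum_(j : I) #|[set x in A | a x == j]%SET| = #|A|)%N.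
Proof.
rewrite -sum1_card (partition_big a xpredT) //=; apply: eq_bigr => j _.
by rewrite -sum1_card; apply: eq_bigl => x; rewrite inE.
Qed.

Section Unfolding.
Variables (N : finType) (R M : Type) (ell : nat) (f : {set N} -> R).
Variables (rd : mr_round N R ell M) (prog : seq (mr_round N R ell M)).
Variable st : 'I_ell -> M.

Lemma mr_adaptivity_cons :
  mr_adaptivity f (rd :: prog) st =
  (\max_(i < ell) adaptivity f (mr_local rd i (st i)) +
   mr_adaptivity f prog (mr_step f rd st))%N.
Proof. by []. Qed.

Lemma mr_queries_cons :
  mr_queries f (rd :: prog) st =
  (\sum_(i < ell) queries f (mr_local rd i (st i)) +
   mr_queries f prog (mr_step f rd st))%N.
Proof. by []. Qed.

Lemma mr_communication_cons :
  mr_communication f (rd :: prog) st =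
  (\sum_(i < ell) \sum_(j < ell) msg_size ((mr_out f rd st i).2 j) +
   mr_communication f prog (mr_step f rd st))%N.
Proof. by []. Qed.

Lemma mr_memory_cons (held : M -> nat) :
  mr_memory f held (rd :: prog) st =
  maxn (\max_(i < ell) held (st i)) (mr_memory f held prog (mr_step f rd st)).
Proof. by []. Qed.

End Unfolding.

Section Execution.
Variables (N : finType) (R : realType) (W : Type) (ell : nat).
Variables (f : {set N} -> R) (Alg : rand_alg N R W) (q : W).
Implicit Types (a : {ffun N -> 'I_ell}) (C : {set N}) (l : seq {ffun N -> 'I_ell}).

Let alg (Y : {set N}) := alg_output f Alg Y q.

(** Broadcasting keeps the core and the best set identical on all machines, so only the parts
    differ. *)
Definition common_state a C (b : {set N} * R) : 'I_ell -> node N R :=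
  fun i => Node (part_of a i) C b.

Definition gdash_loop l : seq (mr_round N R ell (node N R)) :=
  flatten [seq [:: shuffle_round R a; solve_round ell Alg q] | a <- l].

Lemma gdashE T (a : assignments N ell T) :
  gdash Alg a q = init_round N R ell :: gdash_loop [seq a r | r <- enum 'I_T].
Proof. by rewrite /gdash_loop -map_comp. Qed.

Lemma init_step a0 :
  mr_step f (init_round N R ell) (gdash_start R a0) =
  common_state a0 finset.set0 (finset.set0, f finset.set0).
Proof. by []. Qed.

(** Every [x] is forwarded from [a' x] to [a x], so the previous distribution is forgotten. *)
Lemma shuffle_step a a' C b :
  mr_step f (shuffle_round R a) (common_state a' C b) = common_state a C b.
Proof.
apply/funext => j; rewrite /mr_step /= /common_state; congr Node.
apply/setP => x; rewrite !inE; apply/bigcupP/idP => [[i _]|/eqP xj]; first by rewrite !inE => /andP[].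
by exists (a' x) => //; rewrite !inE eqxx xj eqxx.
Qed.

Lemma solve_out a C b i :
  mr_out f (solve_round ell Alg q) (common_state a C b) i =
  (common_state a C b i,
   fun=> (alg (part_of a i :|: C)%SET, [:: f (alg (part_of a i :|: C)%SET)])).
Proof. by rewrite /mr_out /= run_bind. Qed.

Lemma solve_step a C b :
  mr_step f (solve_round ell Alg q) (common_state a C b) =
  common_state a (next_core alg a C) (next_best f alg a C b).
Proof.
apply/funext => j; rewrite /mr_step solve_out /= /common_state; congr Node.
  by congr (_ :|: _)%SET; apply: eq_bigr => i _; rewrite solve_out.
by congr foldl; apply: eq_map => i; rewrite solve_out.
Qed.

Lemma gdash_loop_exec l a C b :
  mr_exec f (gdash_loop l) (common_state a C b) =
  common_state (last a l) (final_core alg l C) (final_best f alg l C b).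
Proof.
by elim: l a C b => //= a' l IH a C b; rewrite shuffle_step solve_step IH.
Qed.

Lemma gdash_rounds T (a : assignments N ell T) : mr_rounds (gdash Alg a q) = T.*2.+1.
Proof.
rewrite gdashE /mr_rounds /=; congr _.+1; rewrite -[in RHS](size_enum_ord T).
by rewrite /gdash_loop; elim: (enum 'I_T) => //= r s ->.
Qed.

Lemma gdash_outputE T a0 (a : assignments N ell T) i :
  gdash_output Alg f a0 a q i =
  (final_best f alg [seq a r | r <- enum 'I_T] finset.set0
     (finset.set0, f finset.set0)).1.
Proof. by rewrite /gdash_output gdashE /= init_step gdash_loop_exec. Qed.

Lemma gdash_loop_cons a l :
  gdash_loop (a :: l) = [:: shuffle_round R a, solve_round ell Alg q & gdash_loop l].
Proof. by []. Qed.

Variable k : nat.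
Hypothesis alg_card : forall Y, (#|alg Y| <= k)%N.

(** Per iteration, the shuffle sends each element once, and the broadcast sends [ell * ell] messages
    of at most [k] elements and one value. *)
Lemma gdash_loop_communication l a C b :
  (mr_communication f (gdash_loop l) (common_state a C b) <=
   size l * (#|N| + ell * (ell * k.+1)))%N.
Proof.
elim: l a C b => // a' l IH a C b; rewrite gdash_loop_cons 2!mr_communication_cons shuffle_step solve_step mulSn addnA.
apply: leq_add (IH _ _ _); apply: leq_add.
  under eq_bigr do under eq_bigr do rewrite /msg_size /= addn0.
  under eq_bigr do rewrite sum_card_fibers.
  rewrite -cardsT -(sum_card_fibers a [set: N]%SET); apply: leq_sum => i _.
  by apply: subset_leq_card; apply/fintype.subsetP => x; rewrite !inE.
apply: (@leq_trans (\sum_(i < ell) \sum_(j < ell) k.+1)).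
  apply: leq_sum => i _; apply: leq_sum => j _.
  by rewrite solve_out /msg_size /= addn1 ltnS.
by rewrite !sum_nat_const !card_ord.
Qed.

Variables (s t m : nat).
Hypothesis st_m : (s + t <= m)%N.

(** Of the three bounds, [s] is for a part, [t] for the core and [m] for the input of a call. *)
Definition balanced a := [forall i, (#|part_of a i| <= s)%N].

Lemma balanced_input a C i : balanced a -> (#|C| <= t)%N ->
  (#|part_of a i :|: C| <= m)%N.
Proof.
move=> /forallP/(_ i) as_ Ct; apply: leq_trans st_m.
exact: leq_trans (leq_card_setU _ _) (leq_add as_ Ct).
Qed.

(** Loop invariant: [t] leaves room for [ell * k] new core elements in each remaining iteration. *)
Lemma next_core_bound a C n : (n.+1 * (ell * k) + #|C| <= t)%N ->
  (n * (ell * k) + #|next_core alg a C| <= t)%N.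
Proof.
apply: leq_trans; rewrite mulSn [(ell * k + _)%N]addnC -addnA leq_add2l.
exact: card_next_core.
Qed.

(** The successor on [Psi m] is the extra adaptive round that evaluates the output of [Alg]. *)
Lemma gdash_loop_adaptivity (Psi : nat -> nat) l a C b :
  adaptive_complexity f Alg Psi ->
  all balanced l -> (size l * (ell * k) + #|C| <= t)%N ->
  (mr_adaptivity f (gdash_loop l) (common_state a C b) <= size l * (Psi m).+1)%N.
Proof.
move=> hPsi; elim: l a C b => // a' l IH a C b /andP[ba bl] Ct.
rewrite gdash_loop_cons 2!mr_adaptivity_cons shuffle_step solve_step mulSn big1 // add0n; apply: leq_add; last first.
  by apply: IH bl _; apply: next_core_bound.
apply/bigmax_leqP => i _; rewrite adaptivity_bind /= addn1 ltnS.
by apply: hPsi; apply: (balanced_input) => //; apply: leq_trans Ct; apply: leq_addl.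
Qed.

Lemma gdash_loop_queries (Phi : nat -> nat) l a C b :
  query_complexity f Alg Phi ->
  all balanced l -> (size l * (ell * k) + #|C| <= t)%N ->
  (mr_queries f (gdash_loop l) (common_state a C b) <= size l * (ell * (Phi m).+1))%N.
Proof.
move=> hPhi; elim: l a C b => // a' l IH a C b /andP[ba bl] Ct.
rewrite gdash_loop_cons 2!mr_queries_cons shuffle_step solve_step mulSn big1 // add0n; apply: leq_add; last first.
  by apply: IH bl _; apply: next_core_bound.
apply: (@leq_trans (\sum_(i < ell) (Phi m).+1)); last by rewrite sum_nat_const card_ord.
apply: leq_sum => i _; rewrite queries_bind /= addn0 addn1 ltnS.
by apply: hPhi; apply: (balanced_input) => //; apply: leq_trans Ct; apply: leq_addl.
Qed.

Lemma common_state_held a C (b : {set N} * R) i p : (#|part_of a i| <= p)%N -> (#|C| <= t)%N ->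
  (#|b.1| <= k)%N -> (node_held (common_state a C b i) <= p + t + k)%N.
Proof. by move=> ap Ct bk; rewrite /node_held /=; rewrite !leq_add. Qed.

(** A separate bound [p] is needed because the current distribution [a] may be the arbitrary initial
    one, which need not be balanced. *)
Lemma gdash_loop_memory p l a C (b : {set N} * R) : (s <= p)%N ->
  (forall i, #|part_of a i| <= p)%N ->
  all balanced l -> (size l * (ell * k) + #|C| <= t)%N -> (#|b.1| <= k)%N ->
  (mr_memory f (@node_held N R) (gdash_loop l) (common_state a C b) <= p + t + k)%N.
Proof.
move=> sp; elim: l a C b => [|a' l IH] a C b ap.
  by move=> _ /= Ct bk; rewrite geq_max andbT; apply/bigmax_leqP => i _; apply: common_state_held.
move=> bal Ct bk; have /andP[ba bl] : balanced a' && all balanced l by [].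
have a'p i : (#|part_of a' i| <= p)%N by apply: leq_trans sp; move/forallP: ba.
have Ct' : (#|C| <= t)%N by apply: leq_trans Ct; apply: leq_addl.
rewrite gdash_loop_cons 2!mr_memory_cons shuffle_step solve_step !geq_max; apply/and3P; split.
- by apply/bigmax_leqP => i _; apply: common_state_held.
- by apply/bigmax_leqP => i _; apply: common_state_held.
- apply: IH => //; first exact: next_core_bound.
  by case: (next_bestP f alg a' C b) => [->|[Y ->]] //=.
Qed.

End Execution.

(** * Balance of the random assignments *)

Lemma bernoulli_ineq (R : realDomainType) (x : R) n :
  0 <= x <= 1 -> 1 - n%:R * x <= (1 - x) ^+ n.
Proof.
move=> /andP[x0 x1]; elim: n => [|n IH]; first by rewrite expr0 mul0r subr0.
have y0 : 0 <= 1 - x by lra.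
rewrite exprS; apply: le_trans (ler_wpM2l y0 IH); rewrite -natr1.
have : 0 <= n%:R * (x * x) :> R by rewrite !mulr_ge0.
by lra.
Qed.

(** The exponential is a product over elements, with factor e on machine [i] and 1 elsewhere; the
    sum over assignments therefore factorizes. *)
Lemma part_of_exp_moment (N : finType) (R : realType) ell (i : 'I_ell) :
  \sum_(a : {ffun N -> 'I_ell}) expR (#|part_of a i|%:R : R) =
  (ell.-1%:R + expR 1) ^+ #|N|.
Proof.
pose w (j : 'I_ell) : R := if j == i then expR 1 else 1.
transitivity (\sum_(a : {ffun N -> 'I_ell}) \prod_x w (a x)).
  apply: eq_bigr => a _.
  rewrite -[#|_|%:R]mulr1 expRM_natl -prodr_const big_mkcond /=.
  by apply: eq_bigr => x _; rewrite inE.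
rewrite -(bigA_distr_bigA (fun (_ : N) j => w j)) /= prodr_const; congr (_ ^+ _).
rewrite (bigD1 i) //= /w eqxx addrC; congr (_ + _).
rewrite (eq_bigr (fun=> 1)) => [|j /negbTE -> //].
rewrite sumr_const; congr (_%:R).
have := cardC1 i; rewrite card_ord => <-.
by apply: eq_card => j; rewrite !inE.
Qed.

Lemma expR1_le4 (R : realType) : expR 1 <= 4 :> R.
Proof.
have h : 2^-1 <= expR (- 2^-1) :> R.
  by apply: le_trans (expR_ge1Dx _); lra.
have h2 : expR 2^-1 <= 2 :> R.
  by rewrite -[leRHS]invrK -[leLHS]invrK -expRN lef_pV2 // posrE ?expR_gt0 ?invr_gt0.
have -> : (1 : R) = 2^-1 + 2^-1 by lra.
rewrite expRD; have := expR_gt0 (2^-1 : R).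
by nra.
Qed.

Section Concentration.
Variables (N : finType) (R : realType) (ell : nat).
Hypothesis ell0 : (0 < ell)%N.

Let B := {ffun N -> 'I_ell}.
Let mu : R := #|N|%:R / ell%:R.

(** Markov's inequality for the exponential moment, in counting form. *)
Lemma card_part_tail (i : 'I_ell) (L : nat) :
  #|[pred a : B | (L * #|N| < ell * #|part_of a i|)%N]|%:R <=
  expR (3 * mu - L%:R * mu) * #|{: B}|%:R.
Proof.
have ellR : 0 < ell%:R :> R by rewrite ltr0n.
have markov : #|[pred a : B | (L * #|N| < ell * #|part_of a i|)%N]|%:R * expR (L%:R * mu) <=
    \sum_(a : B) expR (#|part_of a i|%:R : R).
  rewrite mulr_natl -sumr_const big_mkcond /=; apply: ler_sum => a _.
  case: ifP; last by rewrite ltW ?expR_gt0.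
  rewrite inE => La; rewrite ler_expR /mu mulrA ler_pdivrMr //.
  by rewrite -!natrM ler_nat [leqRHS]mulnC ltnW.
rewrite expRD expRN mulrAC ler_pdivlMr ?expR_gt0 //; apply: le_trans markov _.
rewrite part_of_exp_moment card_ffun card_ord natrX.
(* Since e is at most 4, [ell - 1 + e <= ell + 3 <= ell * expR (3 / ell)]. *)
apply: (@le_trans _ _ ((ell%:R * expR (3 / ell%:R)) ^+ #|N|)).
  apply: lerXn2r; rewrite ?nnegrE ?addr_ge0 ?mulr_ge0 ?expR_ge0 //.
  apply: (@le_trans _ _ (ell%:R * (1 + 3 / ell%:R))); last by rewrite ler_pM2l // expR_ge1Dx.
  rewrite mulrDr mulrCA divff ?gt_eqF // !mulr1.
  have := @expR1_le4 R; rewrite -[in ell%:R](prednK ell0) -natr1; lra.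
rewrite exprMn mulrC -expRM_natl ler_wpM2r ?exprn_ge0 // ler_expR.
by rewrite /mu mulrCA mulrA mulrC.
Qed.

(** Union bound over the machines. *)
Lemma unbalanced_count (L : nat) :
  #|[pred a : B | ~~ balanced ((L * #|N|) %/ ell) a]|%:R <=
  ell%:R * expR (3 * mu - L%:R * mu) * #|{: B}|%:R.
Proof.
apply: (@le_trans _ _ (\sum_(i < ell) #|[pred a : B | (L * #|N| < ell * #|part_of a i|)%N]|%:R)).
  rewrite -natr_sum ler_nat -sum1_card.
  under [leqRHS]eq_bigr do rewrite -sum1_card big_mkcond /=.
  rewrite exchange_big big_mkcond /=; apply: leq_sum => a _; rewrite inE.
  case: ifP => // /forallPn[i]; rewrite leq_divRL // -ltnNge => ai.
  by rewrite (bigD1 i) //= inE [(ell * _)%N]mulnC ai.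
rewrite -mulrA -[X in X%:R * (_ * _)](card_ord ell) mulr_natl -sumr_const.
by apply: ler_sum => i _; apply: card_part_tail.
Qed.

(** The iterations are independent, so the probability is a [T]-th power, which Bernoulli's
    inequality bounds below. *)
Lemma balanced_prob T L :
  T%:R * (ell%:R * expR (3 * mu - L%:R * mu)) <= #|N|%:R^-1 :> R ->
  1 - #|N|%:R^-1 <= unif_prob R
    (fun a : assignments N ell T => [forall r, balanced ((L * #|N|) %/ ell) (a r)]).
Proof.
set s := ((L * #|N|) %/ ell)%N => hT.
have B0 : 0 < #|{: B}|%:R :> R by rewrite ltr0n card_ffun card_ord expn_gt0 ell0.
pose p : R := #|[pred a : B | ~~ balanced s a]|%:R / #|{: B}|%:R.
have p0 : 0 <= p by rewrite divr_ge0.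
have p1 : p <= 1 by rewrite ler_pdivrMr // mul1r ler_nat max_card.
have pE : 1 - p = #|balanced (N:=N) (ell:=ell) s|%:R / #|{: B}|%:R.
  apply/eqP; rewrite subr_eq -mulrDl -natrD.
  have -> : (#|balanced (N:=N) (ell:=ell) s| + #|[pred a : B | ~~ balanced s a]| = #|{: B}|)%N.
    by rewrite -(cardC (balanced (N:=N) (ell:=ell) s)).
  by rewrite divff // gt_eqF.
have -> : unif_prob R (fun a : assignments N ell T => [forall r, balanced s (a r)]) = (1 - p) ^+ T.
  rewrite pE /unif_prob expr_div_n -!natrX; congr (_%:R / _%:R).
    have := @card_ffun_on 'I_T B (balanced s); rewrite card_ord => <-.
    by apply: eq_card => a; rewrite !inE.
  by rewrite card_ffun card_ord.
apply: le_trans (bernoulli_ineq _ _); last by rewrite p0.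
rewrite lerD2l lerN2; apply: le_trans hT; rewrite ler_wpM2l //.
by rewrite ler_pdivrMr //; apply: unbalanced_count.
Qed.

End Concentration.

(** * The approximation ratio *)

(** Bounding the final potential by [f O] in [total_gain] and dividing by [T] costs
    [alpha * f O / T], at most [eps * f O]. The hypothesis [alpha * f O <= f O] stands in for
    [alpha <= 1], which may fail when [f O = 0]. *)
Lemma mean_value (N : finType) (R : realType) (f : {set N} -> R) (ell : nat)
    (alg : {set N} -> {set N}) (k T : nat) (alpha eps : R) (O : {set N}) (i : 'I_ell) :
  set_nonneg f -> set_monotone f -> submodular f -> 0 < alpha ->
  (forall A B : {set N}, [disjoint A & B] ->
    (forall b, b \in B -> b \notin alg (b |: A)) -> alg (A :|: B)%SET = alg A) ->
  (forall Y Z : {set N}, Z \subset Y -> (#|Z| <= k)%N -> alpha * f Z <= f (alg Y)) ->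
  (#|O| <= k)%N -> alpha * f O <= f O -> (0 < T)%N -> 1 <= T%:R * eps ->
  (alpha - eps) * f O <= unif_mean (fun a : assignments N ell T =>
    f (final_best f alg [seq a r | r <- enum 'I_T] finset.set0
         (finset.set0, f finset.set0)).1).
Proof.
move=> f0 fmono fsub alpha0 consistent approx Ok alphaO T0 epsT.
pose best (a : assignments N ell T) := final_best f alg [seq a r | r <- enum 'I_T]
  finset.set0 (finset.set0, f finset.set0).
pose V a := f (best a).1; have VE a : V a = (best a).2.
  by rewrite /V /best;
    case: (final_bestP f alg [seq a r | r <- enum 'I_T] finset.set0 (finset.set0, f finset.set0))
      => [->|[Y ->]].
have B0 : 0 < #|{: assignments N ell T}|%:R :> R.
  by rewrite ltr0n; apply/card_gt0P; exists [ffun=> [ffun=> i]].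
rewrite /unif_mean -/V ler_pdivlMr //.
have gain := total_gain fmono fsub alpha0 consistent approx i T finset.set0 Ok.
have {gain} : \sum_(a : assignments N ell T) (T%:R * f O) <=
    \sum_a (f O + alpha^-1 * (T%:R * V a)).
  apply: le_trans (le_trans _ gain) _; first by apply: ler_sum => a _; rewrite lerDl.
  apply: ler_sum => a _; apply: lerD; first by apply: fmono; apply: finset.subsetIl.
  rewrite ler_wpM2l ?invr_ge0 ?(ltW alpha0) // VE.
  by have := total_value_le f alg i [seq a r | r <- enum 'I_T] finset.set0 (finset.set0, f finset.set0);
     rewrite size_map size_enum_ord.
rewrite big_split /= !sumr_const -!mulr_sumr -(mulr_natr (T%:R * f O)) -(mulr_natr (f O)) => gain.
have T0R : 0 < T%:R :> R by rewrite ltr0n.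
rewrite -(ler_pM2l T0R).
have {gain} : alpha * (T%:R * f O * #|{: assignments N ell T}|%:R) <=
   alpha * (f O * #|{: assignments N ell T}|%:R) + T%:R * \sum_a V a.
  by have := ler_wpM2l (ltW alpha0) gain; rewrite mulrDr mulVKf ?gt_eqF.
have : 0 <= (T%:R * eps * f O - alpha * f O) * #|{: assignments N ell T}|%:R.
  rewrite mulr_ge0 ?ler0n // subr_ge0; apply: le_trans alphaO _.
  by rewrite ler_peMl.
lra.
Qed.

Lemma unif_mean_ge0 (T : finType) (R : realType) (F : T -> R) :
  (forall a, 0 <= F a) -> 0 <= unif_mean F.
Proof. by move=> F0; rewrite divr_ge0 // sumr_ge0. Qed.

Lemma opt_inP (N : finType) (R : realType) (f : {set N} -> R) k (Y : {set N}) :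
  set_nonneg f ->
  exists O : {set N}, [/\ O \subset Y, (#|O| <= k)%N & opt_in f k Y = f O].
Proof.
move=> f0.
have feas0 : (finset.set0 \subset Y) && (#|@finset.set0 N| <= k)%N.
  by rewrite finset.sub0set cards0.
(* The default 0 is traded for the value of the feasible empty set, so that the maximum is attained
   by induction. *)
have -> : opt_in f k Y =
    \big[Num.max/f finset.set0]_(Z : {set N} | (Z \subset Y) && (#|Z| <= k)%N) f Z.
  apply/eqP; rewrite eq_le; apply/andP; split.
    apply: bigmax_le => [|Z feas]; last exact: le_bigmax_cond.
    by apply: le_trans (f0 finset.set0) _; apply: le_bigmax_cond.
  apply: bigmax_le => [|Z feas]; last exact: le_bigmax_cond.
  exact: (le_bigmax_cond _ (fun Z => f Z) feas0).
apply: (big_ind (fun v => exists O : {set N}, [/\ O \subset Y, (#|O| <= k)%N & v = f O])).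
- by exists finset.set0; rewrite finset.sub0set cards0.
- by move=> u v hu hv; rewrite maxEle; case: ifP.
- by move=> Z /andP[ZY Zk]; exists Z.
Qed.

Lemma measurable_finite_comp d (W : measurableType d) (R : realType) (S : finType)
    (h : W -> S) (G : S -> R) :
  (forall s, measurable (h @^-1` [set s])%classic) ->
  measurable_fun [set: W]%classic (G \o h).
Proof.
move=> mh _ B mB; rewrite setTI.
have -> : ((G \o h) @^-1` B = \bigcup_(s in [set s | B (G s)]) h @^-1` [set s])%classic.
  apply/seteqP; split => [q Bq|q [s Bs /= hq]].
  by exists (h q).
  by rewrite /preimage /= hq.
by apply: fin_bigcup_measurable => // s _.
Qed.

(** * Numerical bounds on the parameters *)

Lemma gdash_itersP (R : realType) (eps : R) : 0 < eps <= 1 ->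
  [/\ (0 < gdash_iters eps)%N, 1 <= (gdash_iters eps)%:R * eps &
      (gdash_iters eps)%:R <= 2 / eps].
Proof.
move=> /andP[e0 e1]; have i1 : 1 <= eps^-1 by rewrite invf_ge1.
have /andP[lo hi] := ceil_itv eps^-1.
have c0 : (0 <= Num.ceil eps^-1)%R by rewrite ceil_ge0; lra.
have TE : (gdash_iters eps)%:R = (Num.ceil eps^-1)%:~R :> R.
  by rewrite /gdash_iters natr_absz ger0_norm.
have Te : 1 <= (gdash_iters eps)%:R * eps by rewrite TE -ler_pdivrMr // mul1r.
split => //.
  by rewrite lt0n; apply: contraTneq Te => ->; rewrite mul0r ler10.
by rewrite TE; rewrite rmorphB /= in lo; lra.
Qed.

(** The exponent bound gives [ell <= sqrt n]; the bound on [k] gives [k * ell < eps * psi], while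
    there are at most [2 / eps] iterations. *)
Lemma model_bounds (R : realType) (K c eps : R) (kap n k ell psi : nat) :
  2^-1 <= c -> K <= kap%:R -> (0 < ell)%N -> (0 < k)%N ->
  (n <= ell * psi)%N -> (psi * ell)%:R <= K * n%:R ->
  ell%:R <= powR n%:R (1 - c) -> 0 < eps <= 1 ->
  k%:R < eps * psi%:R / ell%:R ->
  [/\ (0 < n)%N, (psi * ell <= kap * n)%N, (ell * ell <= n)%N,
      (k * ell <= psi)%N & (gdash_iters eps * (k * ell) <= 2 * psi)%N].
Proof.
move=> c2 Kkap ell0 k0 npsi Kn elln eps01 keps.
have [T0 Te T2] := gdash_itersP eps01; have /andP[e0 e1] := eps01.
have ellR : 0 < ell%:R :> R by rewrite ltr0n.
have psin : (psi * ell <= kap * n)%N.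
  by rewrite -(ler_nat R) [leRHS]natrM; apply: le_trans Kn _; rewrite ler_wpM2r.
have kl : (k * ell)%:R < eps * psi%:R by rewrite natrM -ltr_pdivlMr.
have psi0 : (0 < psi)%N.
  by rewrite lt0n; apply: contraTneq kl => ->; rewrite mulr0 -leNgt ler0n.
have n0 : (0 < n)%N.
  rewrite lt0n; apply: contraTneq psin => ->.
  by rewrite muln0 -ltnNge muln_gt0 psi0.
split => //.
- rewrite -(ler_nat R) natrM.
  have h : ell%:R <= Num.sqrt n%:R :> R.
    rewrite -powR12_sqrt //; apply: le_trans elln _; rewrite ler_powR ?ler1n //; lra.
  have s0 := sqrtr_ge0 (n%:R : R).
  by rewrite -[leRHS](sqr_sqrtr (ler0n R n)) expr2 ler_pM.
- rewrite -(ler_nat R); apply: le_trans (ltW kl) _.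
  by rewrite -[leRHS]mul1r ler_wpM2r.
- rewrite -(ler_nat R) natrM [leRHS]natrM.
  apply: le_trans (_ : 2 / eps * (eps * psi%:R) <= _); first by rewrite ler_pM // ltW.
  by rewrite mulrA divfK ?gt_eqF.
Qed.

(* In the coefficient 7 + 2 kap of the part size bound, 3 cancels the exponential moment,
   4 pays for the factor n ^ 2 and 2 kap for the factor 2 * kap. *)
Lemma balanced_arith (R : realType) (kap n ell T : nat) :
  (0 < n)%N -> (0 < ell)%N -> (ell * ell <= n)%N -> (T * ell <= 2 * (kap * n))%N ->
  T%:R * (ell%:R * expR (3 * (n%:R / ell%:R) - (7 + 2 * kap)%:R * (n%:R / ell%:R)))
    <= n%:R^-1 :> R.
Proof.
move=> n0 ell0 ell2 Tell; set mu := n%:R / ell%:R.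
have ellR : 0 < ell%:R :> R by rewrite ltr0n.
have nR : 0 < n%:R :> R by rewrite ltr0n.
have mu1 : 1 <= mu.
  rewrite ler_pdivlMr // mul1r ler_nat; apply: leq_trans ell2; exact: leq_pmull.
(* This is [ell * ell <= n] again; it yields [n <= expR mu ^+ 2] below. *)
have mun : n%:R <= mu * mu.
  rewrite mulrACA -invfM ler_pdivlMr ?mulr_gt0 //.
  by rewrite ler_wpM2l // -natrM ler_nat.
have exp_ge (x : R) : x <= expR x.
  by apply: le_trans (expR_ge1Dx x); rewrite lerDr.
have -> : 3 * mu - (7 + 2 * kap)%:R * mu = - (4%:R * mu + (2 * kap)%:R * mu).
  by rewrite natrD; ring.
rewrite expRN expRD expRM_natl mulrA -natrM.
rewrite ler_pdivrMr ?mulr_gt0 ?exprn_gt0 ?expR_gt0 // mulrC ler_pdivlMr //.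
apply: (@le_trans _ _ (n%:R * n%:R * (2 * kap)%:R)).
  rewrite -!natrM ler_nat; nia.
have e2 : n%:R <= expR mu ^+ 2.
  by apply: le_trans mun _; rewrite expr2 ler_pM ?exp_ge //; lra.
apply: ler_pM; rewrite ?mulr_ge0 //.
  by rewrite (exprD _ 2 2) ler_pM.
apply: le_trans (_ : (2 * kap)%:R * mu <= _); first by rewrite ler_peMr.
exact: exp_ge.
Qed.

(** A call needs [7 + 4 * kap] units of [n / ell], as [2 * psi] is at most [2 * kap] of them; memory
    needs [7 + 2 + 1 + 2 * kap] units of [psi]. The constant [10 + 4 * kap] covers both. *)
Lemma parameter_bounds (kap n ell psi k T : nat) :
  (0 < ell)%N -> (0 < k)%N -> (n <= ell * psi)%N -> (psi * ell <= kap * n)%N ->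
  (k * ell <= psi)%N -> (T * (k * ell) <= 2 * psi)%N ->
  [/\ (T * ell <= 2 * (kap * n))%N,
      ((7 + 2 * kap) * n %/ ell + 2 * psi <= (10 + 4 * kap) * n %/ ell)%N,
      ((7 + 2 * kap) * n %/ ell <= (7 + 2 * kap) * psi)%N,
      (ell * (ell * k.+1) <= 2 * (kap * n))%N &
      ((7 + 2 * kap) * psi + 2 * psi + k <= (10 + 4 * kap) * psi)%N].
Proof.
move=> ell0 k0 npsi psin kpsi Tk.
have psi1 : (psi <= psi * ell)%N by rewrite leq_pmulr.
have k1 : (k <= k * ell)%N by rewrite leq_pmulr.
have ell1 : (ell <= k * ell)%N by rewrite leq_pmull.
split.
- have : (T * ell <= T * (k * ell))%N by rewrite leq_mul2l ell1 orbT.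
  lia.
- rewrite leq_divRL // mulnDl; have := leq_divM ((7 + 2 * kap) * n) ell; lia.
- rewrite -[leqRHS](mulnK _ ell0) leq_div2r // -mulnA leq_mul2l.
  by rewrite [(psi * _)%N]mulnC npsi orbT.
- have : (ell * k.+1 <= 2 * psi)%N by rewrite mulnS; lia.
  by rewrite -(leq_pmul2l ell0); lia.
- lia.
Qed.

(** * Resource bounds and expected value of G-DASH *)

Theorem theorem4 (R : realType) (K c : R) (hc : 2^-1 <= c) :
  exists C : nat,
  forall (N : finType) (f : {set N} -> R) (k ell psi : nat) (eps alpha : R)
    (Phi Psi : nat -> nat)
    (d : measure_display) (W : measurableType d) (P : probability W R)
    (Alg : rand_alg N R W) (a0 : {ffun N -> 'I_ell}) (out : 'I_ell),
  set_nonneg f -> set_monotone f -> submodular f ->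
  (* the MapReduce model *)
  (psi * ell)%:R <= K * #|N|%:R ->
  ell%:R <= powR #|N|%:R (1 - c) ->
  (forall i, #|[pred x | a0 x == i]| <= psi)%N ->
  0 < eps <= 1 -> (0 < k)%N ->
  k%:R < eps * psi%:R / ell%:R ->
  measurable_alg f Alg ->
  randomized_consistency f Alg ->
  approx_ratio f P k Alg alpha ->
  query_complexity f Alg Phi ->
  adaptive_complexity f Alg Psi ->
  let T := gdash_iters eps in
  let start := gdash_start R a0 in
  let m := (C * #|N| %/ ell)%N in
  {ae P, forall q,
    (forall a : assignments N ell T,
      [/\ (#|gdash_output Alg f a0 a q out| <= k)%N,
          (mr_rounds (gdash Alg a q))%:R <= C%:R / eps &
          (mr_communication f (gdash Alg a q) start)%:R
            <= C%:R * #|N|%:R / eps]) /\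
    1 - #|N|%:R^-1 <= unif_prob R (fun a : assignments N ell T =>
      [&& (mr_adaptivity f (gdash Alg a q) start <= T * (Psi m).+1 + 1)%N,
          (mr_queries f (gdash Alg a q) start <= ell * (T * (Phi m).+1 + 1))%N &
          (mr_memory f (@node_held N R) (gdash Alg a q) start <= C * psi)%N])} /\
  (((alpha - eps) * opt_in f k [set: N])%:E <=
     'E_P[fun q => unif_mean (fun a : assignments N ell T =>
                     f (gdash_output Alg f a0 a q out))])%E.
Proof.
pose kap := Num.bound `|K|; pose L := (7 + 2 * kap)%N.
have Kkap : K <= kap%:R by apply: le_trans (ler_norm K) _; apply/ltW/archi_boundP.
exists (10 + 4 * kap)%N => N f k ell psi eps alpha Phi Psi d W P Alg a0 out.
move=> f0 fmono fsub Kn elln a0psi eps01 k0 keps malg consistent approx qPhi aPsi.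
move=> T start m; have [T0 Teps T2] := gdash_itersP eps01.
have ell0 : (0 < ell)%N by apply: leq_ltn_trans (ltn_ord out).
have part0 i : (#|part_of a0 i| <= psi)%N.
  by apply: leq_trans (a0psi i); rewrite eq_leq //; apply: eq_card => x; rewrite !inE.
have npsi : (#|N| <= ell * psi)%N.
  rewrite -cardsT -(sum_card_fibers a0 [set: N]%SET).
  apply: (@leq_trans (\sum_(i < ell) psi)); last by rewrite sum_nat_const card_ord.
  apply: leq_sum => i _; apply: leq_trans (part0 i); apply: subset_leq_card.
  by apply/fintype.subsetP => x; rewrite !inE.
have [n0 psin ell2 kpsi Tk] := model_bounds hc Kkap ell0 k0 npsi Kn elln eps01 keps.
rewrite -/T in T0 Teps T2 Tk.
have [Tell st_m sL comm_le mem_le] := parameter_bounds ell0 k0 npsi psin kpsi Tk.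
rewrite -/L -/m in st_m sL mem_le.
have tail := balanced_arith R n0 ell0 ell2 Tell.
(* There are finitely many inputs, so almost every [q] is good for all of them at once. *)
have {}approx : {ae P, forall q, forall Y,
    [/\ alg_succeeds f Alg Y q, alg_output f Alg Y q \subset Y,
        (#|alg_output f Alg Y q| <= k)%N &
        alpha * opt_in f k Y <= f (alg_output f Alg Y q)]}.
  exact: filter_forall.
split.
  apply: filterS approx => q approx_q.
  pose alg Y := alg_output f Alg Y q.
  have alg_card Y : (#|alg Y| <= k)%N by case: (approx_q Y).
  have core_bound (a : assignments N ell T) :
      (size [seq a r | r <- enum 'I_T] * (ell * k) + #|@finset.set0 N| <= 2 * psi)%N.
    by rewrite size_map size_enum_ord cards0 addn0 (mulnC ell).
  split=> [a|].
    split.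
    - rewrite gdash_outputE; have [->|[Y ->]] := final_bestP f alg [seq a r | r <- enum 'I_T]
        finset.set0 (finset.set0, f finset.set0); last exact: alg_card.
      by rewrite cards0.
    (* [2 * T + 1] is at most [5 / eps]. *)
    - rewrite gdash_rounds -addn1 -muln2 natrD natrM.
      have ieps : 1 <= eps^-1 by rewrite invf_ge1; lra.
      have : 0 <= kap%:R / eps by rewrite divr_ge0 //; lra.
      by rewrite natrD natrM; lra.
    - rewrite gdashE mr_communication_cons init_step big1; last first.
        by move=> i _; rewrite big1 // => j _; rewrite /mr_out /= /msg_size cards0.
      rewrite add0n.
      have := @gdash_loop_communication N R W ell f Alg q k alg_card
        [seq a r | r <- enum 'I_T] a0 finset.set0 (finset.set0, f finset.set0).
      rewrite size_map size_enum_ord => comm.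
      have {comm}/(leq_trans comm) comm' := leq_mul (leqnn T) (leq_add (leqnn #|N|) comm_le).
      move: comm'; rewrite -(ler_nat R) => /le_trans; apply.
      rewrite natrM; apply: le_trans (ler_wpM2r _ T2) _ => //.
      rewrite mulrAC ler_pM2r ?invr_gt0; last by case/andP: eps01.
      rewrite -!natrM ler_nat mulnDr mulnDl -[X in (_ <= _ + X)%N]mulnA mulnA.
      by rewrite leq_add // leq_mul2r orbT.
  (* It remains to see that every assignment balanced in all iterations meets the three bounds. *)
  apply: le_trans (balanced_prob ell0 tail) _.
  rewrite /unif_prob ler_wpM2r ?invr_ge0 ?ler0n // ler_nat.
  apply: subset_leq_card; apply/fintype.subsetP => a /forallP bal.
  rewrite unfold_in; cbv beta.
  have bals : all (balanced ((L * #|N|) %/ ell)) [seq a r | r <- enum 'I_T].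
    by apply/allP => b /mapP[r _ ->].
  rewrite gdashE mr_adaptivity_cons mr_queries_cons mr_memory_cons init_step.
  apply/and3P; split.
  (* The additional round is the initial evaluation of the empty set. *)
  - rewrite addnC leq_add //; last by apply/bigmax_leqP.
    have := gdash_loop_adaptivity alg_card st_m a0 (finset.set0, f finset.set0)
      aPsi bals (core_bound a).
    by rewrite size_map size_enum_ord.
  - rewrite mulnDr addnC leq_add //; last first.
      by rewrite (eq_bigr (fun=> 1%N)) // sum_nat_const card_ord.
    have := gdash_loop_queries alg_card st_m a0 (finset.set0, f finset.set0)
      qPhi bals (core_bound a).
    by rewrite size_map size_enum_ord mulnCA.
  - rewrite geq_max; apply/andP; split.
      apply/bigmax_leqP => i _; rewrite /node_held /= cards0 !addn0.
      by apply: leq_trans (part0 i) _; rewrite leq_pmull // addn_gt0.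
    have := @gdash_loop_memory N R W ell f Alg q k alg_card _ _ (L * psi)%N
      [seq a r | r <- enum 'I_T] a0 finset.set0 (finset.set0, f finset.set0) sL.
    move=> /(_ (2 * psi)%N) mem; apply: leq_trans (mem _ bals (core_bound a) _) mem_le.
    - by move=> i; apply: leq_trans (part0 i) _; rewrite leq_pmull // addn_gt0.
    - by rewrite cards0.
(* The mean depends on q only through the finite table h q, so it is measurable. *)
pose h q := [ffun Y : {set N} => run f (Alg Y q)].
pose G (t : {ffun {set N} -> option {set N}}) : R :=
  unif_mean (fun a : assignments N ell T =>
    f (final_best f (fun Y => odflt finset.set0 (t Y)) [seq a r | r <- enum 'I_T] finset.set0
         (finset.set0, f finset.set0)).1).
have GE : (fun q => unif_mean (fun a : assignments N ell T =>
                     f (gdash_output Alg f a0 a q out))) = G \o h.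
  apply/funext => q; rewrite /G /=; congr unif_mean; apply/funext => a.
  rewrite gdash_outputE; congr (f (final_best _ _ _ _ _).1).
  by apply/funext => Y; rewrite /h ffunE.
have G0 t : 0 <= G t by apply: unif_mean_ge0.
(* A nonpositive target is trivial; a positive one forces [alpha > 0] and makes the constant
   admissible in [expectation_le]. *)
rewrite GE; have [neg|pos] := leP ((alpha - eps) * opt_in f k [set: N]) 0.
  by apply: (@le_trans _ _ 0%E); [rewrite lee_fin | apply: expectation_ge0 => q; exact: G0].
rewrite -(expectation_cst P ((alpha - eps) * opt_in f k [set: N]%SET)).
apply: expectation_le => //.
- apply: measurable_finite_comp => t.
  have -> : (h @^-1` [set t] = \bigcap_(Y in [set: {set N}]) [set q | run f (Alg Y q) = t Y])%classic.
    apply/seteqP; split => q /=; first by move=> <- Y _; rewrite /h /= ffunE.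
    by move=> hq; apply/ffunP => Y; rewrite /h ffunE; apply: hq.
  by apply: fin_bigcap_measurable => [|Y _]; [exact: finite_finset | exact: malg].
- by move=> q; apply: ltW.
- by move=> q; apply: G0.
- apply: filterS approx => q approx_q /=.
  rewrite -[G (h q)]/((G \o h) q) -GE.
  have [S [_ Ok optO]] := opt_inP k [set: N]%SET f0.
  have eps0 : 0 < eps by case/andP: eps01.
  have opt0 : 0 <= opt_in f k [set: N]%SET by rewrite optO.
  have alpha0 : 0 < alpha.
    rewrite ltNge; apply/negP => alpha_le0; move: pos; rewrite ltNge => /negP[].
    by rewrite mulr_le0_ge0 // subr_le0 (le_trans alpha_le0) // ltW.
  (* The output on the whole ground set is feasible, so it is at most the optimum. *)
  have alphaO : alpha * f S <= f S.
    have [_ sub card le] := approx_q [set: N]%SET.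
    by rewrite -optO; apply: le_trans le _; apply: le_bigmax_cond; rewrite sub.
  rewrite optO; have := @mean_value N R f ell (fun Y => alg_output f Alg Y q) k T alpha eps S out
    f0 fmono fsub alpha0 _ _ Ok alphaO T0 Teps.
  under [in X in _ -> X]eq_fun do rewrite gdash_outputE.
  apply.
  + move=> A B AB hB; have [sA _ _ _] := approx_q A.
    by have [] := consistent q A B AB hB sA.
  + move=> Y Z ZY Zk; have [_ _ _ le] := approx_q Y.
    apply: le_trans le; apply: (ler_wpM2l (ltW alpha0)).
    by apply: le_bigmax_cond; rewrite ZY.
Qed.
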